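(* If $\Gamma$ is a connected, one-ended, non-amenable, locally finite, vertex transitive graph, then $\mathsf{wCop}(\Gamma)=\infty$.
   Context: Graphs are undirected, without double edges and without loops. For a connected graph $\Gamma$, $\mathsf{dist}$ is the path distance on $V(\Gamma)$. $\Gamma$ is vertex transitive if for any two vertices $u,v$ some automorphism of $\Gamma$ maps $u$ to $v$. $\Gamma$ is one-ended if for every finite set $K$ of vertices the subgraph $\Gamma-K$ induced by $V(\Gamma)\setminus K$ has exactly one unbounded connected component. For a set $K$ of vertices, $\partial K$ is the set of edges with one endpoint in $K$ and the other not in $K$. The Cheeger constant is $h(\Gamma)=\inf\{|\partial K|/|K| : K\subset V(\Gamma)\text{ non-empty and finite}\}$, and $\Gamma$ is non-amenable if $h(\Gamma)>0$. Game. The cops and robber game on a connected graph $\Gamma$ has parameters: number of cops $n$, cop speed $\sigma$, cop reach $\rho$, robber speed $\psi$, a vertex $v$, and a positive integer $R$. It is a perfect information game. First the $n$ cops choose initial vertices $c^1_0,\dots,c^n_0$; then, knowing these, the robber chooses an initial vertex $r_0$. In stage $k\ge 1$ each cop moves from $c^i_{k-1}$ to a vertex $c^i_k$ with $\mathsf{dist}(c^i_{k-1},c^i_k)\le\sigma$. The robber is captured during stage $k$ if $\mathsf{dist}(r_{k-1},c^i_k)\le\rho$ for some $i$. If not captured, the robber moves from $r_{k-1}$ to a vertex $r_k$ such that there is a path from $r_{k-1}$ to $r_k$ of length at most $\psi$ all of whose vertices are at distance larger than $\rho$ from every $c^i_k$. The cops win (protect the $R$-ball centered at $v$) if the robber is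 captured at some stage or there is $N>0$ such that $\mathsf{dist}(v,r_k)>R$ for all $k\ge N$. $\Gamma$ is $\mathsf{CopWin}(n,\sigma,\rho,\psi,R)$ if for every vertex $v$ of $\Gamma$ the $n$ cops have a winning strategy in the game with parameters $n,\sigma,\rho,\psi,v,R$. $\Gamma$ is $n$-weak cop win if $\exists\,\sigma\in\mathbb{Z}_{>0}\ \exists\,\rho\in\mathbb{Z}_{\ge0}\ \forall\,\psi,R\in\mathbb{Z}_{>0}$: $\Gamma$ is $\mathsf{CopWin}(n,\sigma,\rho,\psi,R)$. The weak cop number $\mathsf{wCop}(\Gamma)\in\mathbb{Z}_{>0}\cup\{\infty\}$ is the smallest positive integer $n$ such that $\Gamma$ is $n$-weak cop win, and $\infty$ if there is none. *)

(* Defs.v *)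
From mathcomp Require Import all_boot all_order all_algebra finmap.
From mathcomp Require Import boolp classical_sets cardinality reals.

Set Implicit Arguments.
Unset Strict Implicit.
Unset Printing Implicit Defensive.

Import Order.TTheory GRing.Theory Num.Theory.

Local Open Scope classical_set_scope.

(* The smallest natural number satisfying P, and None if there is none. *)
Definition least (P : nat -> Prop) : option nat :=
  if pselect (exists n, `[< P n >]) is left exP then Some (ex_minn exP)
  else None.

Record graph := Graph {
  vertex :> choiceType;
  adj : rel vertex;
  adj_sym : symmetric adj;
  adj_irr : irreflexive adj }.

Definition connected_graph (G : graph) : Prop :=
  forall x y : G, exists p : seq G, path (@adj G) x p /\ last x p = y.

(* The path distance; the value 0 for vertices not joined by any path is a
   dummy, irrelevant in a connected graph. *)
Definition dist (G : graph) (x y : G) : nat :=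
  odflt 0 (least (fun n => exists p : seq G,
    [/\ path (@adj G) x p, last x p = y & size p = n])).

Definition locally_finite (G : graph) : Prop :=
  forall x : G, finite_set [set y : G | adj x y].

Definition automorphism (G : graph) (f : G -> G) : Prop :=
  bijective f /\ forall x y : G, adj (f x) (f y) = adj x y.

Definition vertex_transitive (G : graph) : Prop :=
  forall u v : G, exists f : G -> G, automorphism f /\ f u = v.

Definition bounded (G : graph) (A : set G) : Prop :=
  exists m : nat, forall x y : G, A x -> A y -> dist x y <= m.

Definition component (G : graph) (K : {fset G}) (x : G) : set G :=
  [set y | exists p : seq G,
    [/\ path (@adj G) x p, last x p = y & {in x :: p, forall z, z \notin K}]].

(* C is (the vertex set of) a connected component of G - K. *)
Definition is_component (G : graph) (K : {fset G}) (C : set G) : Prop :=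
  exists2 x : G, x \notin K & C = component K x.

Definition one_ended (G : graph) : Prop :=
  forall K : {fset G}, exists! C : set G, is_component K C /\ ~ bounded C.

(* An edge is the two-element set of its endpoints. *)
Definition edges (G : graph) : set {fset G} :=
  [set E | exists x y : G, adj x y /\ E = [fset x; y]%fset].

Definition boundary (G : graph) (K : {fset G}) : set {fset G} :=
  [set E | edges E /\
     exists x y : G, [/\ E = [fset x; y]%fset, x \in K & y \notin K]].

(* fset_set sends infinite sets to fset0, but in a locally finite graph the
   boundary of a finite set is finite. *)
Definition cheeger (R : realType) (G : graph) : R :=
  inf [set (#|` fset_set (boundary K)|%:R / #|` K|%:R)%R
      | K in [set K : {fset G} | K != fset0]].

Definition nonamenable (R : realType) (G : graph) : Prop :=
  (0 < cheeger R G)%R.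

Definition cop_position (G : graph) (n : nat) := 'I_n -> G.

(* A strategy of the cops gives their position at stage k from the history
   [:: (c_0, r_0); ...; (c_(k-1), r_(k-1))]; on the empty history it gives
   their initial position. *)
Definition strategy (G : graph) (n : nat) :=
  seq (cop_position G n * G) -> cop_position G n.

Definition follows (G : graph) (n : nat) (s : strategy G n)
    (c : nat -> cop_position G n) (r : nat -> G) : Prop :=
  forall k : nat, c k = s (mkseq (fun j => (c j, r j)) k).

Definition cop_move (G : graph) (n sigma : nat) (c c' : cop_position G n) :
    Prop :=
  forall i : 'I_n, dist (c i) (c' i) <= sigma.

Definition in_reach (G : graph) (n rho : nat) (c : cop_position G n) (x : G) :
    Prop :=
  exists i : 'I_n, dist x (c i) <= rho.

Definition robber_move (G : graph) (n rho psi : nat) (c : cop_position G n)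
    (x y : G) : Prop :=
  exists p : seq G, [/\ path (@adj G) x p, last x p = y, size p <= psi &
    {in x :: p, forall z, ~ in_reach rho c z}].

Definition captured_at (G : graph) (n rho : nat)
    (c : nat -> cop_position G n) (r : nat -> G) (k : nat) : Prop :=
  0 < k /\ in_reach rho (c k) (r k.-1).

Definition free_until (G : graph) (n rho : nat)
    (c : nat -> cop_position G n) (r : nat -> G) (k : nat) : Prop :=
  forall j : nat, j <= k -> ~ captured_at rho c r j.

(* Plays are infinite sequences of positions. A play really ends at the first
   capture, so what comes after it is unconstrained. A robber who has not been
   captured may always stay in place, hence every finite play without capture
   that respects the rules is an initial segment of such a sequence. *)
Definition robber_legal (G : graph) (n rho psi : nat)
    (c : nat -> cop_position G n) (r : nat -> G) : Prop :=
  forall k : nat, free_until rho c r k.+1 ->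
    robber_move rho psi (c k.+1) (r k) (r k.+1).

Definition cops_legal (G : graph) (n sigma rho : nat)
    (c : nat -> cop_position G n) (r : nat -> G) : Prop :=
  forall k : nat, free_until rho c r k -> cop_move sigma (c k) (c k.+1).

Definition cops_win (G : graph) (n rho : nat) (v : G) (rad : nat)
    (c : nat -> cop_position G n) (r : nat -> G) : Prop :=
  (exists k : nat, captured_at rho c r k) \/
  (exists2 N : nat, 0 < N & forall k : nat, N <= k -> rad < dist v (r k)).

Definition winning (G : graph) (n sigma rho psi : nat) (v : G) (rad : nat)
    (s : strategy G n) : Prop :=
  forall (c : nat -> cop_position G n) (r : nat -> G),
    follows s c r -> robber_legal rho psi c r ->
    cops_legal sigma rho c r /\ cops_win rho v rad c r.

Definition CopWin (G : graph) (n sigma rho psi rad : nat) : Prop :=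
  forall v : G, exists s : strategy G n, winning sigma rho psi v rad s.

Definition weak_cop_win (G : graph) (n : nat) : Prop :=
  exists2 sigma : nat, 0 < sigma & exists rho : nat,
    forall psi rad : nat, 0 < psi -> 0 < rad -> CopWin G n sigma rho psi rad.

(* None stands for infinity. *)
Definition wCop (G : graph) : option nat :=
  least (fun n => 0 < n /\ weak_cop_win G n).

(* Main.v *)
Require Import Defs.
From mathcomp Require Import all_boot all_order all_algebra finmap.
From mathcomp Require Import boolp classical_sets cardinality reals.


(** Whatever the number n of cops, their speed sigma and their reach rho, the
robber has a fixed finite set X of vertices on which he can stay forever,
provided that he is fast enough.

Call the zone of a position of the cops the union of the balls of radius
rho + sigma around them. By vertex transitivity its size is at most a constant
Z independent of the position, and all degrees are at most some d. Suppose
that every vertex of a finite set X either is in the zone or lies in a bounded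
component of its complement. Then the zone together with these components is a
finite set containing X whose boundary edges all have an endpoint in the zone,
so h |X| <= d Z, where h > 0 is the Cheeger constant. If X has more than d Z / h
elements, this is impossible: X always contains a vertex in the unbounded
component of the complement of the zone ([escape_set_exists]).

The robber moves to such a vertex after each move of the cops. A cop that was
farther than rho + sigma from him cannot come within rho of him in one move, so
he is never captured. His old vertex x and his new one y both lie in the unique
unbounded component of the complement of the rho-balls around the present
position of the cops ([escapes_component]), so some path avoiding these balls
joins them. Its length must be bounded independently of the position of the
cops, in order to serve as the speed of the robber; this is [uniform_walk]: a
cop far away from X does not interfere with short paths between points of X, and
the cops close to X have only finitely many positions.

As X is finite, it is contained in a ball around any given vertex, and the cops
do not protect that ball ([robber_wins]). *)

Set Implicit Arguments.
Unset Strict Implicit.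
Unset Printing Implicit Defensive.

Import Order.TTheory GRing.Theory Num.Theory.

Local Open Scope fset_scope.
Local Open Scope nat_scope.

(** * Walks, components and distances *)

(** The moves of the robber in the graph with the vertices of K deleted; with
the bound L dropped this is membership in [component K x]. *)
Definition walk (G : graph) (K : {fset G}) (L : nat) (x y : G) : Prop :=
  exists p : seq G, [/\ path (@adj G) x p, last x p = y, size p <= L &
    {in x :: p, forall z, z \notin K}].

Lemma walk_monotone (G : graph) (K : {fset G}) (L L' : nat) (x y : G) :
  L <= L' -> walk K L x y -> walk K L' x y.
Proof.
move=> LL' [p [xp xy pL pK]]; exists p; split=> //; exact: leq_trans LL'.
Qed.

Lemma component_walk (G : graph) (K : {fset G}) (x y : G) :
  component K x y <-> exists L, walk K L x y.
Proof.
split=> [[p [xp xy pK]]|[L [p [xp xy _ pK]]]]; last by exists p.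
by exists (size p), p.
Qed.

Lemma component_self (G : graph) (K : {fset G}) (x : G) :
  x \notin K -> component K x x.
Proof. by move=> xK; exists [::]; split=> // z; rewrite inE => /eqP ->. Qed.

Lemma component_start (G : graph) (K : {fset G}) (x y : G) :
  component K x y -> x \notin K.
Proof. by case=> p [_ _ pK]; apply: pK; rewrite mem_head. Qed.

Lemma component_adj (G : graph) (K : {fset G}) (x y z : G) :
  component K x y -> adj y z -> z \notin K -> component K x z.
Proof.
move=> [p [xp xy pK]] yz zK; exists (rcons p z).
split; rewrite ?rcons_path ?xp ?xy ?last_rcons // => t.
by rewrite -rcons_cons mem_rcons inE => /orP[/eqP -> //|/pK].
Qed.

Lemma component_antitone (G : graph) (K K' : {fset G}) (x y : G) :
  K `<=` K' -> component K' x y -> component K x y.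
Proof.
move=> /fsubsetP KK' [p [xp xy pK]]; exists p; split=> // z /pK.
by apply: contra; apply: KK'.
Qed.

Lemma dist_le_walk (G : graph) (x : G) (p : seq G) :
  path (@adj G) x p -> dist x (last x p) <= size p.
Proof.
move=> xp; rewrite /dist /least; case: pselect => [exP|] /=; last first.
  by case; exists (size p); apply/asboolP; exists p.
by case: ex_minnP => m _; apply; apply/asboolP; exists p.
Qed.

Lemma geodesic (G : graph) (x y : G) : connected_graph G ->
  exists p : seq G, [/\ path (@adj G) x p, last x p = y & size p = dist x y].
Proof.
move=> conG; rewrite /dist /least; case: pselect => [exP|] /=.
  by case: ex_minnP => m /asboolP.
by have [p [xp xy]] := conG x y; case; exists (size p); apply/asboolP; exists p.
Qed.

Lemma dist_sym (G : graph) (x y : G) :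
  connected_graph G -> dist x y = dist y x.
Proof.
move=> conG; wlog suff: x y / dist x y <= dist y x => [le|].
  by apply/eqP; rewrite eqn_leq !le.
have [p [yp yx <-]] := geodesic y x conG.
have yE : last x (rev (belast y p)) = y.
  by rewrite -yx; case: (p) => //= z q; rewrite rev_cons last_rcons.
rewrite -[X in dist _ X]yE -(size_belast y p) -size_rev; apply: dist_le_walk.
rewrite -[X in path _ X]yx rev_path.
by apply: sub_path yp => u v; rewrite adj_sym.
Qed.

Lemma dist_triangle (G : graph) (x y z : G) : connected_graph G ->
  dist x z <= dist x y + dist y z.
Proof.
move=> conG; have [p [xp xy <-]] := geodesic x y conG.
have [q [yq yz <-]] := geodesic y z conG.
have zE : last x (p ++ q) = z by rewrite last_cat xy.
by rewrite -[X in dist _ X]zE -size_cat dist_le_walk // cat_path xp xy.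
Qed.

Lemma dist_le_in_walk (G : graph) (x z : G) (p : seq G) :
  path (@adj G) x p -> z \in x :: p -> dist x z <= size p.
Proof.
move=> xp; rewrite inE => /orP[/eqP -> |zp].
  exact: leq_trans (@dist_le_walk G x [::] isT) _.
case/splitPr: zp xp => p1 p2; rewrite cat_path /= => /and3P[xp1 lz _].
have /dist_le_walk : path (@adj G) x (rcons p1 z) by rewrite rcons_path xp1.
rewrite last_rcons size_rcons size_cat => /leq_trans; apply.
by rewrite /= addnS ltnS leq_addr.
Qed.

(** * Balls *)

Definition neighbours (G : graph) (x : G) : {fset G} :=
  fset_set [set y : G | adj x y].

Lemma mem_neighbours (G : graph) (x y : G) : locally_finite G ->
  (y \in neighbours x) = adj x y.
Proof.
by move=> lfG; rewrite /neighbours in_fset_set ?mem_setE //; apply: lfG.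
Qed.

Fixpoint ball (G : graph) (m : nat) (x : G) : {fset G} :=
  if m is m'.+1 then x |` \bigcup_(y <- neighbours x) ball m' y else [fset x].

Lemma mem_ball (G : graph) (m : nat) (x y : G) :
  connected_graph G -> locally_finite G ->
  (y \in ball m x) = (dist x y <= m).
Proof.
move=> conG lfG; elim: m x => [|m IHm] x /=.
  rewrite inE; apply/eqP/idP => [->|].
    exact: (@dist_le_walk G x [::]).
  by have [p [_ <- <-]] := geodesic x y conG; case: p.
rewrite inE in_fset1; apply/orP/idP => [[/eqP ->|]|].
- exact: leq_trans (@dist_le_walk G x [::] isT) _.
- case/bigfcupP => z; rewrite andbT mem_neighbours // IHm => xz zy.
  apply: leq_trans (dist_triangle _ z _ conG) _; rewrite -add1n leq_add //.
  by apply: (@dist_le_walk G x [:: z]); rewrite /= xz.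
- have [[|z p] [/= xp xy <-]] := geodesic x y conG.
    by rewrite xy eqxx; left.
  case/andP: xp => xz zp; rewrite ltnS => pm; right.
  apply/bigfcupP; exists z; first by rewrite andbT mem_neighbours.
  by rewrite IHm -xy (leq_trans (dist_le_walk zp)).
Qed.

Lemma card_bigfcup_le (I : eqType) (T : choiceType) (s : seq I)
    (F : I -> {fset T}) (b : nat) :
  (forall i, #|` F i| <= b) -> #|` \bigcup_(i <- s) F i| <= size s * b.
Proof.
move=> Fb; elim: s => [|i s IHs]; first by rewrite big_nil cardfs0.
rewrite big_cons mulSn (leq_trans (leq_card_fsetU _ _)) //.
by rewrite leq_add.
Qed.

(** An automorphism maps the neighbours of a vertex onto those of its image, so
all degrees agree. *)
Lemma transitive_degree_bound (G : graph) :
  locally_finite G -> vertex_transitive G ->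
  exists d : nat, forall x : G, #|` neighbours x| <= d.
Proof.
move=> lfG vtG; have [[v _]|noG] := pselect (exists v : G, True); last first.
  by exists 0 => x; case: noG; exists x.
exists #|` neighbours v| => x; have [f [[[g fK gK] fadj] <-]] := vtG v x.
apply: leq_trans (leq_imfset_card imfset_key f (mem (neighbours v))).
apply: fsubset_leq_card; apply/fsubsetP => y; rewrite mem_neighbours // => fy.
apply/imfsetP; exists (g y); last by rewrite gK.
by rewrite /= mem_neighbours // -fadj gK.
Qed.

Lemma ball_card_bound (G : graph) (d : nat) :
  (forall x : G, #|` neighbours x| <= d) ->
  forall m, exists b : nat, forall x : G, #|` ball m x| <= b.
Proof.
move=> deg; elim=> [|m [b IHm]]; first by exists 1 => x; rewrite cardfs1.
exists (1 + d * b) => x /=; apply: leq_trans (leq_card_fsetU _ _) _.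
rewrite cardfs1 leq_add2l (leq_trans (card_bigfcup_le _ IHm)) //.
by rewrite leq_mul2r deg orbT.
Qed.

(** For cops at the vertices in s, the robber must avoid the zone for m = rho in
his moves, and the zone for m = rho + sigma when he stops. *)
Definition zone (G : graph) (m : nat) (s : seq G) : {fset G} :=
  \bigcup_(c <- s) ball m c.

Lemma mem_zone (G : graph) (m : nat) (s : seq G) (x : G) :
  connected_graph G -> locally_finite G ->
  reflect (exists2 c, c \in s & dist x c <= m) (x \in zone m s).
Proof.
move=> conG lfG; apply: (iffP (bigfcupP _ _ _ _)) => -[c].
  by rewrite andbT mem_ball // dist_sym // => cs xc; exists c.
by move=> cs xc; exists c; rewrite ?cs // mem_ball // dist_sym.
Qed.

Lemma bounded_finite (G : graph) (A : set G) :
  connected_graph G -> locally_finite G -> bounded A -> finite_set A.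
Proof.
move=> conG lfG [m Am]; have [[x Ax]|noA] := pselect (exists x, A x).
  apply: (@sub_finite_set _ _ [set` ball m x]) => [y Ay|]; last exact: finite_fset.
  by rewrite /= mem_ball // Am.
have -> : A = set0 by apply/seteqP; split=> // x Ax; case: noA; exists x.
exact: finite_set0.
Qed.

(** * Non-amenability *)

Lemma cheeger_boundary (R : realType) (G : graph) (K : {fset G}) :
  K != fset0 ->
  (cheeger R G * #|` K|%:R <= #|` fset_set (boundary K)|%:R)%R.
Proof.
move=> K0; have K_gt0 : (0 < #|` K|%:R :> R)%R by rewrite ltr0n cardfs_gt0.
rewrite -ler_pdivlMr //; apply: ge_inf; last by exists K.
by exists 0%R => _ [A _ <-]; rewrite divr_ge0 ?ler0n.
Qed.

(** Every boundary edge of A is determined by its endpoint in K and one of the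
at most d neighbours of that endpoint. *)
Lemma boundary_card_le (G : graph) (A K : {fset G}) (d : nat) :
  locally_finite G -> (forall x : G, #|` neighbours x| <= d) ->
  (forall x y, x \in A -> y \notin A -> adj x y -> x \in K) ->
  #|` fset_set (boundary A)| <= #|` K| * d.
Proof.
move=> lfG deg AK.
pose E := \bigcup_(x <- K) [fset [fset x; y] | y in neighbours x].
have subE : (boundary A `<=` [set` E])%classic.
  move=> e [[a [b [ab eab]]] [x [y [exy xA yA]]]] /=.
  have xy : adj x y.
    have /fset2P xab : x \in [fset a; b] by rewrite -eab exy fset21.
    have /fset2P yab : y \in [fset a; b] by rewrite -eab exy fset22.
    have neq : x <> y by move=> xy; rewrite xy (negPf yA) in xA.
    by case: xab yab neq => -> [] -> //; rewrite adj_sym.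
  apply/bigfcupP; exists x; first by rewrite andbT (AK x y).
  by rewrite exy; apply/imfsetP; exists y => //=; rewrite mem_neighbours.
have finA : finite_set (boundary A) := sub_finite_set subE (finite_fset E).
apply: (@leq_trans #|` E|).
  apply: fsubset_leq_card; apply/fsubsetP => e.
  by rewrite in_fset_set // => /set_mem /subE.
by apply: card_bigfcup_le => x; apply: leq_trans (deg x); apply: leq_imfset_card.
Qed.

(** The safe vertices: when G is one-ended, they form the unbounded component of
G - K. *)
Definition escapes (G : graph) (K : {fset G}) (x : G) : Prop :=
  x \notin K /\ ~ bounded (component K x).

(** The union of K with the components of G - K that meet X contains X and is
finite, and an edge can leave it only from K, since a component of G - K is
closed under adjacency outside K. Hence its boundary is controlled by K, and the
isoperimetric inequality applied to it bounds X. *)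
Lemma trapped_card (R : realType) (G : graph) (d : nat) (X K : {fset G}) :
  connected_graph G -> locally_finite G ->
  (forall x : G, #|` neighbours x| <= d) -> X != fset0 ->
  (forall x, x \in X -> ~ escapes K x) -> (0 <= cheeger R G)%R ->
  (cheeger R G * #|` X|%:R <= (#|` K| * d)%:R)%R.
Proof.
move=> conG lfG deg X0 trapped h0.
pose S := ([set` K] `|` \bigcup_(x in [set` X]) component K x)%classic.
have finS : finite_set S.
  rewrite finite_setU; split; first exact: finite_fset.
  apply: bigcup_finite => [|x xX]; first exact: finite_fset.
  (* For x in K the component is empty. *)
  apply: bounded_finite => //.
  have [xK|/negP/negP xK] := boolP (x \in K).
    by exists 0 => y z /component_start; rewrite xK.
  by apply: contrapT => unb; apply: (trapped x xX).
pose A := fset_set S.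
have AE z : z \in A <-> S z.
  by rewrite /A in_fset_set //; split=> [/set_mem|/mem_set].
have XA : X `<=` A.
  apply/fsubsetP => x xX; apply/AE.
  have [xK|xK] := boolP (x \in K); first by left.
  by right; exists x => //; apply: component_self.
have A0 : A != fset0.
  by apply: contraNneq X0 => A0; rewrite -fsubset0 -A0.
apply: (@le_trans _ _ (cheeger R G * #|` A|%:R)%R).
  by rewrite ler_wpM2l // ler_nat fsubset_leq_card.
apply: le_trans (cheeger_boundary R A0) _; rewrite ler_nat.
apply: boundary_card_le => // x y /AE[//|[z zX zx] /negP yA xy].
case: yA; apply/AE; have [yK|yK] := boolP (y \in K); first by left.
by right; exists z => //; apply: component_adj zx xy yK.
Qed.

(** * One-endedness *)

(** The bound of [trapped_card] depends on the zone only through its size, which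
is bounded independently of where its centres are; a large enough X therefore
works for all positions of n cops at once. *)
Lemma escape_set_exists (R : realType) (G : graph) (n m : nat) :
  connected_graph G -> one_ended G -> nonamenable R G ->
  locally_finite G -> vertex_transitive G ->
  exists X : {fset G}, forall s : seq G, size s <= n ->
    exists2 x, x \in X & escapes (zone m s) x.
Proof.
move=> conG oneG namG lfG vtG.
have [d deg] := transitive_degree_bound lfG vtG.
have [b ballb] := ball_card_bound deg m.
have infG : infinite_set [set: G].
  move=> finG; have [C [[[x _ ->] unb] _]] := oneG fset0; apply: unb.
  exists (\max_(y <- fset_set [set: G]) \max_(z <- fset_set [set: G]) dist y z).
  move=> y z _ _.
  have inG t : t \in fset_set [set: G] by rewrite in_fset_set //; apply: mem_set.
  apply: leq_trans (leq_bigmax_seq y (inG y) isT).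
  exact: (leq_bigmax_seq z (inG z) isT).
(* N exceeds (n * b * d) / h, where n * b bounds the size of the zone. *)
pose N := Num.bound ((n * b * d)%:R / cheeger R G)%R.
have [X _ XN] := infinite_set_fset N.+1 infG.
have X0 : X != fset0 by rewrite -cardfs_gt0 (leq_trans _ XN).
exists X => s sn; apply: contrapT => none.
have : (cheeger R G * #|` X|%:R <= (#|` zone m s| * d)%:R)%R.
  apply: trapped_card => //; last exact: ltW.
  by move=> x xX xesc; apply: none; exists x.
apply/negP; rewrite -ltNge.
apply: (@le_lt_trans _ _ (n * b * d)%:R%R).
  rewrite ler_nat leq_mul2r (leq_trans (card_bigfcup_le _ ballb)) ?orbT //.
  by rewrite leq_mul2r sn orbT.
rewrite mulrC -ltr_pdivrMr //; apply: lt_le_trans (archi_boundP _) _.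
  by rewrite divr_ge0 ?ler0n // ltW.
by rewrite ler_nat ltnW.
Qed.

(** Deleting fewer vertices only enlarges components, so x and y both lie in
unbounded components of G - K, and there is only one. In the game K is the zone
of radius rho of the present cops, which is contained in the zones of radius
rho + sigma of both the previous and the present cops. *)
Lemma escapes_component (G : graph) (K K1 K2 : {fset G}) (x y : G) :
  one_ended G -> K `<=` K1 -> K `<=` K2 ->
  escapes K1 x -> escapes K2 y -> component K x y.
Proof.
move=> oneG KK1 KK2.
have weaken (K' : {fset G}) z : K `<=` K' -> escapes K' z -> escapes K z.
  move=> /[dup] KK' /fsubsetP sub [zK unb]; split.
    by apply: contra zK; apply: sub.
  move=> [m bm]; apply: unb; exists m => u v zu zv.
  by apply: bm; apply: component_antitone KK' _.
move=> /(weaken _ _ KK1)[xK xunb] /(weaken _ _ KK2)[yK yunb].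
have [C [_ Cuniq]] := oneG K.
have -> : component K x = component K y.
  by rewrite -[LHS]Cuniq -?[RHS]Cuniq //; split=> //; [exists y | exists x].
exact: component_self.
Qed.

(** * Uniform length of detours *)

Lemma uniform_bound (T : eqType) (P : T -> nat -> Prop) (s : seq T) :
  (forall x m n, m <= n -> P x m -> P x n) ->
  (forall x, exists L, P x L) -> exists L, {in s, forall x, P x L}.
Proof.
move=> Pmono Pex; elim: s => [|x s [L IHs]]; first by exists 0.
have [L' PxL'] := Pex x; exists (maxn L' L) => y; rewrite inE.
case/orP=> [/eqP -> |/IHs]; first exact: Pmono (leq_maxl _ _) PxL'.
exact: Pmono (leq_maxr _ _).
Qed.

(** Two points of X that can be joined while avoiding K and the cops can be
joined within a length that does not depend on the position of the cops.
Induction on the number of cops, for all K. Let L0 be the bound for K and one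
cop fewer. If the first cop is farther than L0 + rho from X, then a path of
length at most L0 starting in X that avoids the other cops avoids its ball as
well. Otherwise it has only finitely many positions, and for each of them its
ball can be added to K. *)
Lemma uniform_walk (G : graph) (rho n : nat) (X K : {fset G}) :
  connected_graph G -> locally_finite G ->
  exists L, forall s : seq G, size s = n -> {in X &, forall x y,
    component (K `|` zone rho s) x y -> walk (K `|` zone rho s) L x y}.
Proof.
move=> conG lfG; elim: n K => [|n IHn] K.
  have [x|x|L HL] := @uniform_bound G (fun x L => {in X, forall y,
    component K x y -> walk K L x y}) X.
  - by move=> m m' mm' W y yX xy; apply: walk_monotone mm' (W y yX xy).
  - apply: (@uniform_bound G (fun y L => component K x y -> walk K L x y)).
      by move=> y m m' mm' W xy; apply: walk_monotone mm' (W xy).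
    move=> y; have [/component_walk[L W]|no] := pselect (component K x y).
      by exists L.
    by exists 0.
  exists L => s /size0nil ->; rewrite /zone big_nil fsetU0 => x y xX yX.
  exact: HL.
have [L0 HL0] := IHn K.
have [c m m' mm' W s sn x y xX yX xy|c|L HL] := @uniform_bound G
  (fun c L => forall s, size s = n -> {in X &, forall x y,
     component (K `|` ball rho c `|` zone rho s) x y ->
     walk (K `|` ball rho c `|` zone rho s) L x y}) (zone (L0 + rho) X).
- exact: walk_monotone mm' (W s sn x y xX yX xy).
- exact: IHn.
exists (maxn L0 L) => -[//|c s] [sn] x y xX yX.
rewrite /zone big_cons fsetUA -/(zone rho s).
have [near|far] := boolP (c \in zone (L0 + rho) X) => xy.
  exact: walk_monotone (leq_maxr _ _) (HL c near s sn x y xX yX xy).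
have [] := HL0 s sn x y xX yX.
  apply: component_antitone xy.
  by rewrite fsubUset fsubsetUr andbT -fsetUA fsubsetUl.
move=> p [xp xy' pL pK]; exists p; split=> //.
  by rewrite (leq_trans pL) ?leq_maxl.
move=> z zp; have := pK z zp; rewrite !inE !negb_or => /andP[-> ->] /=.
rewrite andbT; apply: contra far; rewrite mem_ball // => cz.
apply/mem_zone => //; exists x => //.
rewrite dist_sym // (leq_trans (dist_triangle x z c conG)) //.
by rewrite leq_add ?(leq_trans (dist_le_in_walk xp zp)) // dist_sym.
Qed.

(** * The game *)

Lemma in_reachP (G : graph) (n m : nat) (c : cop_position G n) (x : G) :
  connected_graph G -> locally_finite G ->
  reflect (in_reach m c x) (x \in zone m (codom c)).
Proof.
move=> conG lfG.
apply: (iffP (mem_zone _ _ _ conG lfG)) => [[_ /codomP[i ->]]|[i xi]].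
  by exists i.
by exists (c i) => //; apply: codom_f.
Qed.

(** This is why the robber keeps farther than rho + sigma from the cops: their
next move cannot bring him within their reach. *)
Lemma zone_subset_after_move (G : graph) (n sigma rho : nat)
    (c c' : cop_position G n) :
  connected_graph G -> locally_finite G -> cop_move sigma c c' ->
  zone rho (codom c') `<=` zone (rho + sigma) (codom c).
Proof.
move=> conG lfG cc'; apply/fsubsetP => x /in_reachP-/(_ conG lfG)[i xi].
apply/in_reachP => //; exists i.
apply: leq_trans (dist_triangle _ (c' i) _ conG) _.
by rewrite leq_add // dist_sym.
Qed.

Lemma zone_radius_monotone (G : graph) (m m' : nat) (s : seq G) :
  connected_graph G -> locally_finite G -> m <= m' ->
  zone m s `<=` zone m' s.
Proof.
move=> conG lfG mm'; apply/fsubsetP => x /mem_zone-/(_ conG lfG)[c cs xc].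
by apply/mem_zone => //; exists c => //; apply: leq_trans mm'.
Qed.

Lemma walk_robber_move (G : graph) (n rho psi : nat) (c : cop_position G n)
    (x y : G) : connected_graph G -> locally_finite G ->
  walk (zone rho (codom c)) psi x y -> robber_move rho psi c x y.
Proof.
move=> conG lfG [p [xp xy pL pK]]; exists p; split=> // z /pK.
by move=> + /in_reachP zc; rewrite zc.
Qed.

(** * The robber's strategy *)

(** Against any strategy of the cops, a robber whose choice depends only on the
new position of the cops and on his own last vertex determines a play: the
history is built by recursion, and the two sequences are read off it. *)
Lemma play_against (G : graph) (n : nat) (s : strategy G n)
    (f : cop_position G n -> G) (g : cop_position G n -> G -> G) :
  exists c : nat -> cop_position G n, exists r : nat -> G,
    [/\ follows s c r, r 0 = f (c 0) & forall k, r k.+1 = g (c k.+1) (r k)].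
Proof.
pose reply (h : seq (cop_position G n * G)) :=
  if h is e :: h' then g (s h) (last e h').2 else f (s h).
pose hist := fix hist k := if k is k'.+1
  then rcons (hist k') (s (hist k'), reply (hist k')) else [::].
exists (s \o hist), (reply \o hist); split=> // k.
  congr s; rewrite /=; elim: k => // k IHk.
  by rewrite mkseqS -IHk.
rewrite /reply /=; case: (hist k) => [|e h] //=.
by rewrite last_rcons.
Qed.

(** The robber stops at a safe vertex [f c] of X chosen from the position c of
the cops alone. He goes there if this is a legal move and otherwise stays where
he is. The second option never occurs, but it makes his play legal without
assuming anything about the cops; only for a legal play does a winning strategy
promise that the cops move legally, and this is what shows in turn that he can
always reach [f c]. *)
Lemma robber_wins (G : graph) (n sigma rho psi rad : nat) (v : G)
    (X : {fset G}) :
  connected_graph G -> one_ended G -> locally_finite G ->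
  (forall s : seq G, size s <= n ->
     exists2 x, x \in X & escapes (zone (rho + sigma) s) x) ->
  (forall s : seq G, size s = n -> {in X &, forall x y,
     component (zone rho s) x y -> walk (zone rho s) psi x y}) ->
  {in X, forall x, dist v x <= rad} ->
  ~ exists s : strategy G n, winning sigma rho psi v rad s.
Proof.
move=> conG oneG lfG Xesc Xwalk Xrad [s win].
have size_pos (c : cop_position G n) : size (codom c) = n.
  by rewrite size_codom card_ord.
have /choice[f fP] (c : cop_position G n) :
    exists x, x \in X /\ escapes (zone (rho + sigma) (codom c)) x.
  by have [|x] := Xesc (codom c); [rewrite size_pos | exists x].
have [c [r [sc r0 rS]]] := play_against s f
  (fun c x => if `[< robber_move rho psi c x (f c) >] then f c else x).
have legal : robber_legal rho psi c r.
  move=> k free; rewrite rS; case: asboolP => // _.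
  exists [::]; split=> // z; rewrite inE => /eqP -> caught.
  exact: (free k.+1).
have [clegal] := win c r sc legal.
(* At every stage the robber is free and sits at his safe vertex. *)
have inv k : free_until rho c r k /\ r k = f (c k).
  elim: k => [|k [free rk]].
    by split=> // j; rewrite leqn0 => /eqP -> [].
  have sub := zone_subset_after_move rho conG lfG (clegal k free).
  have free' : free_until rho c r k.+1.
    move=> j; rewrite leq_eqVlt => /orP[/eqP ->|]; last exact: free.
    move=> [_ /in_reachP-/(_ conG lfG)]; rewrite /= rk => /(fsubsetP sub).
    by apply/negP; case: (fP (c k)).2.
  split=> //; rewrite rS; case: asboolP => // -[].
  apply: walk_robber_move => //; apply: Xwalk; rewrite ?size_pos ?rk //;
    try exact: (fP _).1.
  apply: escapes_component (fP _).2 (fP _).2 => //.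
  by apply: zone_radius_monotone => //; apply: leq_addr.
case=> [[k]|[N _ far]]; first exact: (inv k).1.
have := far N (leqnn N); rewrite (inv N).2.
by apply/negP; rewrite -leqNgt; apply: Xrad; apply: (fP _).1.
Qed.

Theorem theorem8 (R : realType) (G : graph) :
  connected_graph G -> one_ended G -> nonamenable R G ->
  locally_finite G -> vertex_transitive G ->
  wCop G = None.
Proof.
move=> conG oneG namG lfG vtG; rewrite /wCop /least.
case: pselect => // exn; exfalso.
have [n /asboolP[_ [sigma _ [rho win]]]] := exn.
have [X Xesc] := escape_set_exists n (rho + sigma) conG oneG namG lfG vtG.
have [L XL] := uniform_walk rho n X fset0 conG lfG.
have [_ [[[v _ _] _] _]] := oneG fset0.
have [x m m' mm' xm|x|rad Xrad] := @uniform_bound G (fun x m => dist v x <= m) X.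
- exact: leq_trans mm'.
- by exists (dist v x).
(* The game asks for a positive speed and a positive radius. *)
apply: (@robber_wins G n sigma rho L.+1 rad.+1 v X) => //.
- move=> s sn x y xX yX; have := XL s sn x y xX yX; rewrite fset0U => W /W.
  exact: walk_monotone.
- by move=> x /Xrad /leqW.
exact: win.
Qed.
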